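(* For every unbounded flexible suspension of Type I-OEE, II-AEE, II-OEE or III-OAE, all dihedral angles $\varepsilon_k$ at the juncture edges and all dihedral angles $\delta_k,\delta'_k$ at the parallel edges ($k=1,\dots,N$) are non-constant under flexion, i.e. non-constant as the variable of flexion $\theta$ varies.
   Context: Juncture parameters: for an even integer $N=2M\ge 4$, real numbers $L_k>0$ and $\beta_k,B_k\in(0,\pi)$, $k=1,\dots,N$; the index $k$ is cyclic mod $N$. Types: I-OEE: $L_{k+M}=L_k$, $B_k=\beta_{k+M}$, $B_{k+M}=\beta_k$ for $k=1,\dots,M$, and $\sum_{k=1}^N L_k\cos\beta_k=\sum_{k=1}^N L_k\cos B_k=0$. II-AEE: $L_{N-k+1}=L_k$ for $k=1,\dots,M$, $B_k=\beta_{N-k+1}$ for $k=1,\dots,N$, and $\sum_{k=1}^N L_k\cos\beta_k=\sum_{k=1}^N L_k\cos B_k=0$. II-OEE: $L_{k+M}=L_k$, $\beta_{k+M}=\beta_k$, $B_{k+M}=B_k$ for $k=1,\dots,M$, and $\sum_{k=1}^M L_k\cos\beta_k=\sum_{k=1}^M L_k\cos B_k=0$. III-OAE: there are $\beta,B\in(0,\pi)$ and an integer $L$ ($3\le L\le N-2$ if $N\ge6$; $L=3$ if $N=4$) such that, with $k_x=\lfloor L/2\rfloor$ and $h=k_x-1$ if $L$ is even, $h=k_x$ if $L$ is odd: $(\beta_{2k-1},B_{2k-1})=(\beta,B)$ for $1\le k\le k_x$ and $(\pi-\beta,\pi-B)$ for $k_x<k\le M$; $(\beta_{2k},B_{2k})=(\pi-B,\pi-\beta)$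 for $1\le k\le h$ and $(B,\beta)$ for $h<k\le M$; and $\sum_{k=1}^{h}L_{2k}=\sum_{k=h+1}^{M}L_{2k}$, $\sum_{k=1}^{k_x}L_{2k-1}=\sum_{k=k_x+1}^{M}L_{2k-1}$. Unbounded flexible suspension and its flexion. Let $\mathbf u=(-\sin\theta,-\cos\theta,0)$ and $\mathbf w=(\sin\theta,-\cos\theta,0)$. Given parameters of one of the four types, the vertices are $\mathbf v_{k+1}=\mathbf v_k+\Delta\mathbf v_k$, where $\Delta\mathbf v_k=(\Delta x_k,\Delta y_k,\Delta z_k)$ with $$\Delta x_k=\frac{L_k(\cos B_k-\cos\beta_k)}{2\sin\theta},\qquad \Delta y_k=\frac{-L_k(\cos B_k+\cos\beta_k)}{2\cos\theta},\qquad \Delta z_k=\pm\sqrt{L_k^2-\Delta x_k^2-\Delta y_k^2},$$ so that $|\Delta\mathbf v_k|=L_k$, $\Delta\mathbf v_k\cdot\mathbf u=L_k\cos\beta_k$, $\Delta\mathbf v_k\cdot\mathbf w=L_k\cos B_k$. The signs are chosen so that $\sum_{k=1}^N\Delta z_k=0$: $\Delta z_{k+M}=-\Delta z_k$ ($k=1,\dots,M$) for I-OEE and II-OEE; $\Delta z_{N-k+1}=-\Delta z_k$ ($k=1,\dots,M$) for II-AEE; and for III-OAE, where each $|\Delta z_k|$ is $L_k$ times a factor common to all $k$, signs for which $\sum_k\pm L_k=0$ by the two length equalities above. The polygon then closes up, for any choice of $\mathbf v_1$. The unbounded suspension has as faces the half-strips $\{\mathbf p+s\mathbf u:\mathbf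 p\in[\mathbf v_k,\mathbf v_{k+1}],\ s\ge0\}$ and $\{\mathbf p+s\mathbf w:\mathbf p\in[\mathbf v_k,\mathbf v_{k+1}],\ s\ge0\}$; its juncture edges are $[\mathbf v_k,\mathbf v_{k+1}]$ and its parallel edges are the rays from $\mathbf v_k$ in directions $\mathbf u$ and $\mathbf w$. Its flexion is the motion obtained by varying $\theta$ with all $\beta_k,B_k,L_k$ fixed. Self-intersections are allowed. Dihedral angles: $\varepsilon_k$ is the angle between the two faces meeting at $[\mathbf v_k,\mathbf v_{k+1}]$ (the angle between the components of $\mathbf u$ and $\mathbf w$ orthogonal to $\mathbf v_{k+1}-\mathbf v_k$); $\delta_k$ (resp. $\delta'_k$) is the angle between the two faces meeting at the parallel edge from $\mathbf v_k$ in direction $\mathbf u$ (resp. $\mathbf w$).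
   Formalization: For δ_k and δ'_k it is assumed that v_{k-1}, v_k, v_{k+1} are not collinear for every θ of the flexion; otherwise the claim fails (II-OEE, N=4, L_k=1, all angles π/2, signs +,+,−,− gives δ_2=π for all θ). The ε_k claim is unrestricted. *)

(* Defs.v *)
From HB Require Import structures.
From mathcomp Require Import all_boot all_order all_algebra.
From mathcomp Require Import reals trigo.

Set Implicit Arguments.
Unset Strict Implicit.
Unset Printing Implicit Defensive.

Import Order.TTheory GRing.Theory Num.Theory.

Local Open Scope ring_scope.

Section Euclidean3.
Variable R : realType.
Implicit Types x y d : 'rV[R]_3.

Definition vec3 (p q r : R) : 'rV[R]_3 := \row_i [:: p; q; r]`_i.

Definition dot x y : R := (x *m y^T) 0 0.

(* The canonical norm `|x| of 'rV[R]_3 is the sup norm. *)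
Definition enorm x : R := Num.sqrt (dot x x).

Definition angle x y : R := acos (dot x y / (enorm x * enorm y)).

Definition orth d x : 'rV[R]_3 := x - (dot x d / dot d d) *: d.

(* Angle between the half-planes bounded by the line of direction d which point
   towards x and y. *)
Definition dihedral d x y : R := angle (orth d x) (orth d y).

End Euclidean3.

(* Indices are natural numbers 1, ..., N with N = 2M; the values of the
   families at other indices are irrelevant.  [Beta] is the family B_k.
   [zneg k] is true when Delta z_k is the negative square root.  [base theta]
   is the position of v_1.  The signs do not depend on theta: over an open
   interval of theta the quantity under each square root, if nonnegative, is
   positive, so that a continuous motion preserves the signs. *)
Record suspension (R : realType) := Suspension {
  half : nat;
  len : nat -> R;
  beta : nat -> R;
  Beta : nat -> R;
  zneg : nat -> bool;
  base : R -> 'rV[R]_3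
}.

Inductive suspension_type := I_OEE | II_AEE | II_OEE | III_OAE.

Section Suspension.
Variables (R : realType) (S : suspension R).

Local Notation M := (half S).
Local Notation N := (half S).*2.
Local Notation L := (len S).
Local Notation b := (beta S).
Local Notation B := (Beta S).

Definition nsides : nat := N.

Definition juncture_parameters : Prop :=
  (4 <= N)%N /\
  forall k, (1 <= k <= N)%N ->
    [/\ 0 < L k, 0 < b k < pi & 0 < B k < pi].

Definition closing_sums : Prop :=
  \sum_(1 <= k < N.+1) L k * cos (b k) = 0 /\
  \sum_(1 <= k < N.+1) L k * cos (B k) = 0.

Definition is_I_OEE : Prop :=
  (forall k, (1 <= k <= M)%N ->
    [/\ L (k + M)%N = L k, B k = b (k + M)%N & B (k + M)%N = b k]) /\
  closing_sums.

Definition is_II_AEE : Prop :=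
  [/\ forall k, (1 <= k <= M)%N -> L (N - k + 1)%N = L k,
      forall k, (1 <= k <= N)%N -> B k = b (N - k + 1)%N
    & closing_sums].

Definition is_II_OEE : Prop :=
  [/\ forall k, (1 <= k <= M)%N ->
        [/\ L (k + M)%N = L k, b (k + M)%N = b k & B (k + M)%N = B k],
      \sum_(1 <= k < M.+1) L k * cos (b k) = 0
    & \sum_(1 <= k < M.+1) L k * cos (B k) = 0].

Definition is_III_OAE : Prop :=
  exists (b0 B0 : R) (l : nat),
    let kx := l./2 in
    let h := if odd l then kx else kx.-1 in
    [/\ 0 < b0 < pi /\ 0 < B0 < pi,
        if N == 4%N then l = 3%N else (3 <= l <= N - 2)%N,
        (forall k, (1 <= k <= kx)%N ->
           b (2 * k - 1)%N = b0 /\ B (2 * k - 1)%N = B0) /\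
        (forall k, (kx < k <= M)%N ->
           b (2 * k - 1)%N = pi - b0 /\ B (2 * k - 1)%N = pi - B0),
        (forall k, (1 <= k <= h)%N ->
           b (2 * k)%N = pi - B0 /\ B (2 * k)%N = pi - b0) /\
        (forall k, (h < k <= M)%N ->
           b (2 * k)%N = B0 /\ B (2 * k)%N = b0)
      & \sum_(1 <= k < h.+1) L (2 * k)%N =
          \sum_(h.+1 <= k < M.+1) L (2 * k)%N /\
        \sum_(1 <= k < kx.+1) L (2 * k - 1)%N =
          \sum_(kx.+1 <= k < M.+1) L (2 * k - 1)%N].

Definition of_type (t : suspension_type) : Prop :=
  match t with
  | I_OEE => is_I_OEE
  | II_AEE => is_II_AEE
  | II_OEE => is_II_OEE
  | III_OAE => is_III_OAE
  end.

(* The choice of signs making the sum of the Delta z_k vanish.  For III-OAE,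
   |Delta z_k| / L_k does not depend on k, and every choice of signs with
   sum_k +-L_k = 0 is allowed. *)
Definition closing_signs (t : suspension_type) : Prop :=
  match t with
  | I_OEE | II_OEE =>
      forall k, (1 <= k <= M)%N -> zneg S (k + M)%N = ~~ zneg S k
  | II_AEE =>
      forall k, (1 <= k <= M)%N -> zneg S (N - k + 1)%N = ~~ zneg S k
  | III_OAE => \sum_(1 <= k < N.+1) (-1) ^+ zneg S k * L k = 0
  end.

Definition dir_u (theta : R) : 'rV[R]_3 := vec3 (- sin theta) (- cos theta) 0.
Definition dir_w (theta : R) : 'rV[R]_3 := vec3 (sin theta) (- cos theta) 0.

Definition dx (k : nat) (theta : R) : R :=
  L k * (cos (B k) - cos (b k)) / (2 * sin theta).

Definition dy (k : nat) (theta : R) : R :=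
  - (L k * (cos (B k) + cos (b k))) / (2 * cos theta).

Definition dz2 (k : nat) (theta : R) : R :=
  L k ^+ 2 - dx k theta ^+ 2 - dy k theta ^+ 2.

Definition dz (k : nat) (theta : R) : R :=
  (-1) ^+ zneg S k * Num.sqrt (dz2 k theta).

Definition dv (k : nat) (theta : R) : 'rV[R]_3 :=
  vec3 (dx k theta) (dy k theta) (dz k theta).

Definition vertex (k : nat) (theta : R) : 'rV[R]_3 :=
  base S theta + \sum_(1 <= j < k) dv j theta.

Definition next (k : nat) : nat := if k == N then 1%N else k.+1.
Definition prev (k : nat) : nat := if k == 1%N then N else k.-1.

(* Needed because of the conventions x / 0 = 0 and sqrt x = 0 for x < 0. *)
Definition realizable (theta : R) : Prop :=
  [/\ sin theta != 0, cos theta != 0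
    & forall k, (1 <= k <= N)%N -> 0 <= dz2 k theta].

Definition flexes_on (a c : R) : Prop :=
  a < c /\ forall theta, a < theta < c -> realizable theta.

Definition eps (k : nat) (theta : R) : R :=
  dihedral (vertex (next k) theta - vertex k theta)
           (dir_u theta) (dir_w theta).

Definition delta (k : nat) (theta : R) : R :=
  dihedral (dir_u theta)
           (vertex (prev k) theta - vertex k theta)
           (vertex (next k) theta - vertex k theta).

Definition delta' (k : nat) (theta : R) : R :=
  dihedral (dir_w theta)
           (vertex (prev k) theta - vertex k theta)
           (vertex (next k) theta - vertex k theta).

(* v_(k-1), v_k, v_(k+1) are not collinear throughout the flexion.  The
   conditions on the parameters do not exclude that they are, for instance when
   the edges k-1 and k carry the same angles and the same sign; then the two
   half-strips along each ray from v_k stay coplanar, the ray is not an edge of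
   the surface, and the angle there is constantly 0 or pi. *)
Definition proper_vertex (a c : R) (k : nat) : Prop :=
  exists2 theta, a < theta < c &
    row_free (col_mx (vertex (prev k) theta - vertex k theta)
                     (vertex (next k) theta - vertex k theta)).

End Suspension.

Definition nonconstant_on (R : realType) (a c : R) (f : R -> R) : Prop :=
  exists theta1 theta2 : R,
    [/\ a < theta1 < c, a < theta2 < c & f theta1 <> f theta2].

(* Main.v *)
(** Each juncture edge makes constant angles with [u] and [w], so the cosine of
    an angle at a juncture edge is an affine function of [cos (2 theta)].
    The cosine of an angle at a parallel edge from [v_k] is an affine function
    of [dv (k - 1) . dv k].  If the latter is a constant [K], clearing
    denominators and squaring gives a polynomial identity of degree 4 in
    [sin theta ^+ 2], whose leading coefficients read
    [K ^+ 2 = (L (k - 1) * L k) ^+ 2]; this is the equality case of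
    Cauchy-Schwarz, so the two edges are parallel throughout the flexion. *)
Require Import Defs.
From HB Require Import structures.
From mathcomp Require Import all_boot all_order all_algebra.
From mathcomp Require Import boolp reals trigo.
From mathcomp Require Import zify ring lra.

Set Implicit Arguments.
Unset Strict Implicit.
Unset Printing Implicit Defensive.

Import Order.TTheory GRing.Theory Num.Theory.

Local Open Scope ring_scope.

(** * Scalar products, Cauchy-Schwarz and dihedral angles *)

Section Vectors.
Variable R : realType.
Implicit Types x y z d e : 'rV[R]_3.

Lemma dotE x y :
  dot x y = x 0 0 * y 0 0 + x 0 1 * y 0 1 + x 0 (1 + 1) * y 0 (1 + 1).
Proof.
rewrite /dot !mxE !big_ord_recl big_ord0 !mxE addr0 addrA.
by congr (_ + _ + _); congr (x _ _ * y _ _); apply: val_inj.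
Qed.

Lemma dot_vec3 (p q r p' q' r' : R) :
  dot (vec3 p q r) (vec3 p' q' r') = p * p' + q * q' + r * r'.
Proof. by rewrite dotE !mxE. Qed.

Lemma dotC x y : dot x y = dot y x.
Proof. by rewrite !dotE; ring. Qed.

Lemma dotNl x y : dot (- x) y = - dot x y.
Proof. by rewrite !dotE !mxE; ring. Qed.

Lemma dot_sqr_ge0 x : 0 <= dot x x.
Proof. by rewrite dotE; nra. Qed.

Lemma dot_sqr_eq0 x : dot x x = 0 -> x = 0.
Proof.
rewrite dotE -!expr2 => /eqP.
rewrite !paddr_eq0 ?addr_ge0 ?sqr_ge0// !sqrf_eq0.
case/andP=> /andP[/eqP x0 /eqP x1] /eqP x2.
apply/rowP=> -[[|[|[|//]]] i3]; rewrite mxE.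
- by rewrite -x0; congr (x _ _); apply: val_inj.
- by rewrite -x1; congr (x _ _); apply: val_inj.
- by rewrite -x2; congr (x _ _); apply: val_inj.
Qed.

(** [z] is [dot x x] times the component of [y] orthogonal to [x]. That its square is nonnegative
    gives Cauchy-Schwarz; that it vanishes gives the equality case. *)
Lemma dot_lagrange x y :
  let z := dot x x *: y - dot x y *: x in
  dot z z = dot x x * (dot x x * dot y y - dot x y ^+ 2).
Proof. by rewrite /= !dotE !mxE; ring. Qed.

Lemma cauchy_schwarz x y : dot x y ^+ 2 <= dot x x * dot y y.
Proof.
have [x0|x0] := eqVneq (dot x x) 0.
  by rewrite (dot_sqr_eq0 x0) !dotE !mxE; lra.
have x_gt0 : 0 < dot x x by rewrite lt_def x0 dot_sqr_ge0.
by have := dot_sqr_ge0 (dot x x *: y - dot x y *: x);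
  rewrite dot_lagrange pmulr_rge0// subr_ge0.
Qed.

(** By [dot_lagrange] the combination with coefficients [- dot x y] and [dot x x] vanishes, and the
    second coefficient is nonzero. *)
Lemma cauchy_schwarz_eq_not_free x y : dot x x != 0 ->
  dot x y ^+ 2 = dot x x * dot y y -> ~~ row_free (col_mx x y).
Proof.
move=> x0 eqxy; apply/negP => free_xy.
have z0 : dot x x *: y - dot x y *: x = 0.
  by apply: dot_sqr_eq0; rewrite dot_lagrange eqxy subrr mulr0.
have := mulmx_free_eq0 (row_mx (- dot x y)%:M (dot x x)%:M) free_xy.
rewrite mul_row_col !mul_scalar_mx scaleNr addrC z0 eqxx => /esym/eqP.
rewrite -[0]row_mx0 => /eq_row_mx[_ /matrixP/(_ 0 0)].
by rewrite !mxE mulr1n => /eqP; apply/negP.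
Qed.

(** Cauchy-Schwarz puts the quotient where [cos] inverts [acos]; for a zero vector the quotient is 0
    by the convention on division. *)
Lemma cos_angle x y : cos (angle x y) = dot x y / (enorm x * enorm y).
Proof.
apply: acosK; rewrite in_itv /= -ler_norml.
have [n0|n0] := eqVneq (enorm x * enorm y) 0.
  by rewrite n0 invr0 mulr0 normr0 ler01.
have n_gt0 : 0 < enorm x * enorm y by rewrite lt_def n0 mulr_ge0 ?sqrtr_ge0.
rewrite normrM normfV (gtr0_norm n_gt0) ler_pdivrMr// mul1r.
rewrite -(@ler_pXn2r _ 2) ?nnegrE ?normr_ge0 ?(ltW n_gt0)//.
by rewrite real_normK ?num_real// exprMn !sqr_sqrtr ?dot_sqr_ge0 ?cauchy_schwarz.
Qed.

Lemma dot_orth d x y : dot d d != 0 ->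
  dot (orth d x) (orth d y) = dot x y - dot x d * dot y d / dot d d.
Proof.
move=> d0; rewrite /orth.
have -> : dot (x - (dot x d / dot d d) *: d) (y - (dot y d / dot d d) *: d)
  = dot x y - (dot x d / dot d d) * dot d y - (dot y d / dot d d) * dot x d
    + (dot x d / dot d d) * (dot y d / dot d d) * dot d d.
  set s := _ / _; set t := _ / _.
  by rewrite !dotE !mxE; ring.
by rewrite (dotC d y); field.
Qed.

Lemma cos_dihedral d x y : dot d d != 0 ->
  cos (dihedral d x y) = (dot x y - dot x d * dot y d / dot d d) /
    (Num.sqrt (dot x x - dot x d ^+ 2 / dot d d) *
     Num.sqrt (dot y y - dot y d ^+ 2 / dot d d)).
Proof. by move=> d0; rewrite cos_angle /enorm !dot_orth. Qed.

End Vectors.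

(** * Squares of sines, a quartic identity, sums in two blocks *)

Section RealFunctions.
Variable R : realType.

Lemma nonconstant_or (a c : R) (f : R -> R) : ~ nonconstant_on a c f ->
  forall x y, a < x < c -> a < y < c -> f x = f y.
Proof. by move=> nf x y hx hy; apply: contrapT => fxy; apply: nf; exists x, y. Qed.

(** The difference of the squares factors into sines and cosines of the midpoint and of the
    half-difference. The latter lies strictly between 0 and [pi / 2]; the former will be handled by
    realizability. *)
Lemma sin_sqr_neq (x y : R) : x < y < x + pi ->
  sin ((x + y) / 2) != 0 -> cos ((x + y) / 2) != 0 ->
  sin x ^+ 2 != sin y ^+ 2.
Proof.
move=> /andP[xy yx] s0 c0; rewrite -subr_eq0.
have e1 : x = (x + y) / 2 - (y - x) / 2 by field.
have e2 : y = (x + y) / 2 + (y - x) / 2 by field.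
have -> : sin x = sin ((x + y) / 2 - (y - x) / 2) by rewrite -e1.
have -> : sin y = sin ((x + y) / 2 + (y - x) / 2) by rewrite -e2.
rewrite sinB sinD.
have s2 : 0 < sin ((y - x) / 2).
  by apply: sin_gt0_pi; have := @pi_gt0 R; lra.
have c2 : 0 < cos ((y - x) / 2).
  by apply: cos_gt0_pihalf; have := @pi_gt0 R; lra.
move: (sin _) (cos _) (sin ((y - x) / 2)) (cos ((y - x) / 2)) s0 c0 s2 c2.
move=> s c' u v s0 c0 u0 v0.
have -> : (s * v - c' * u) ^+ 2 - (s * v + c' * u) ^+ 2
    = - (4 * (s * c' * (u * v))) by ring.
by rewrite oppr_eq0 !mulf_eq0 (negbTE s0) (negbTE c0) !gt_eqF.
Qed.

(** The difference of the two sides is a polynomial in [t] of degree at most 4 with at least five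
    roots, hence zero; the claim is its coefficient of degree 4. *)
Lemma quadratic_sqr_lead (p2 p1 p0 r2 r1 r0 q2 q1 q0 : R) (ts : seq R) :
  uniq ts -> (4 < size ts)%N ->
  (forall t, t \in ts -> (q2 * t ^+ 2 + q1 * t + q0) ^+ 2 =
    (p2 * t ^+ 2 + p1 * t + p0) * (r2 * t ^+ 2 + r1 * t + r0)) ->
  q2 ^+ 2 = p2 * r2.
Proof.
move=> uts sts H.
pose p : {poly R} := Poly [:: q0 ^+ 2 - p0 * r0;
  2 * q0 * q1 - p0 * r1 - p1 * r0;
  q1 ^+ 2 + 2 * q0 * q2 - p0 * r2 - p1 * r1 - p2 * r0;
  2 * q1 * q2 - p1 * r2 - p2 * r1; q2 ^+ 2 - p2 * r2].
have p_eq0 : p = 0.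
  apply: (@roots_geq_poly_eq0 _ _ ts) => //; last first.
    by apply: leq_trans sts; apply: size_Poly.
  apply/allP => t /H Ht; apply/eqP; rewrite horner_Poly /=.
  move/eqP: Ht; rewrite -subr_eq0 => /eqP Ht.
  by rewrite -[RHS]Ht; ring.
have := coef_Poly [:: q0 ^+ 2 - p0 * r0;
  2 * q0 * q1 - p0 * r1 - p1 * r0;
  q1 ^+ 2 + 2 * q0 * q2 - p0 * r2 - p1 * r1 - p2 * r0;
  2 * q1 * q2 - p1 * r2 - p2 * r1; q2 ^+ 2 - p2 * r2] 4.
by rewrite -/p p_eq0 coef0 /= => /eqP; rewrite eq_sym subr_eq0 => /eqP.
Qed.

(** Serves type III-OAE: across the cut each angle passes to its supplement, so its cosine changes
    sign, and both blocks have the same total length. *)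
Lemma split_sum_cancel (F : nat -> R) (r : R) h m :
  (h <= m)%N ->
  \sum_(1 <= k < h.+1) F k = \sum_(h.+1 <= k < m.+1) F k ->
  forall G : nat -> R,
  (forall k, (1 <= k <= h)%N -> G k = r) ->
  (forall k, (h < k <= m)%N -> G k = - r) ->
  \sum_(1 <= k < m.+1) F k * G k = 0.
Proof.
move=> hm sF G G1 G2; rewrite (big_cat_nat (n := h.+1)) //=.
rewrite (eq_big_nat _ _ (F2 := fun k => F k * r)); last first.
  by move=> k hk; rewrite G1.
rewrite [X in _ + X](eq_big_nat _ _ (F2 := fun k => F k * - r)); last first.
  by move=> k hk; rewrite G2.
by rewrite -!mulr_suml sF mulrN subrr.
Qed.

End RealFunctions.

(** * Sums over pairs of indices: opposite, mirrored, odd with even *)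

Section PairingSums.
Variable V : nmodType.
Implicit Type F : nat -> V.

Lemma sum_pair_shift F m :
  \sum_(1 <= k < m.*2.+1) F k = \sum_(1 <= k < m.+1) (F k + F (k + m)%N).
Proof.
rewrite (big_cat_nat (n := m.+1)) //=; last by lia.
rewrite big_split /=; congr (_ + _).
rewrite -{1}[m.+1]add1n big_addn; congr (\sum_(_ <= k < _) _); lia.
Qed.

Lemma sum_pair_rev F m :
  \sum_(1 <= k < m.*2.+1) F k =
    \sum_(1 <= k < m.+1) (F k + F (m.*2 - k + 1)%N).
Proof.
rewrite (big_cat_nat (n := m.+1)) //=; last by lia.
rewrite big_split /=; congr (_ + _).
rewrite big_nat_rev /= -{1}[m.+1]add1n big_addn.
have -> : (m.*2.+1 - m)%N = m.+1 by lia.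
by apply: eq_big_nat => k km; congr F; lia.
Qed.

Lemma sum_pair_parity F m :
  \sum_(1 <= k < m.*2.+1) F k =
    \sum_(1 <= k < m.+1) (F (2 * k - 1)%N + F (2 * k)%N).
Proof.
elim: m => [|m IH]; first by rewrite !big_geq.
rewrite doubleS big_nat_recr//= big_nat_recr//= IH [in RHS]big_nat_recr//=.
by rewrite -addrA; congr (_ + (F _ + F _)); lia.
Qed.

End PairingSums.

(** * Closing of the polygon *)

Section Flexion.
Variables (R : realType) (S : suspension R).
Local Notation M := (Defs.half S).
Local Notation N := (Defs.half S).*2.
Local Notation L := (len S).
Local Notation b := (beta S).
Local Notation B := (Beta S).

(** Types I-OEE and II-AEE contain these sums by definition. For II-OEE the full sum is twice the
    sum over half of the edges. For III-OAE the odd and the even indices cancel separately, by the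
    two equalities of lengths. *)
Lemma type_closing_sums t : of_type S t -> closing_sums S.
Proof.
case: t => [[] //|[] //|[per sb sB]|].
  split; rewrite sum_pair_shift big_split /=.
    rewrite sb add0r -[RHS]sb; apply: eq_big_nat => k hk.
    by have [-> -> _] := per k hk.
  rewrite sB add0r -[RHS]sB; apply: eq_big_nat => k hk.
  by have [-> _ ->] := per k hk.
case=> b0 [B0 [l /=]]; set h := if odd l then _ else _.
case=> _ hl [o1 o2] [e1 e2] [se so].
have [hM kM] : (h <= M)%N /\ (l./2 <= M)%N.
  by rewrite /h; move: hl; case: eqP => ?; case: ifP => ? ?; split; lia.
split; rewrite sum_pair_parity big_split /=.
- rewrite (split_sum_cancel (r := cos b0) kM so); first last.
  + by move=> k /o2[-> _]; rewrite cosB cospi sinpi mul0r addr0 mulN1r.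
  + by move=> k /o1[->].
  rewrite (split_sum_cancel (r := - cos B0) hM se) ?addr0//.
  + by move=> k /e1[-> _]; rewrite cosB cospi sinpi mul0r addr0 mulN1r.
  + by move=> k /e2[-> _]; rewrite opprK.
- rewrite (split_sum_cancel (r := cos B0) kM so); first last.
  + by move=> k /o2[_ ->]; rewrite cosB cospi sinpi mul0r addr0 mulN1r.
  + by move=> k /o1[_ ->].
  rewrite (split_sum_cancel (r := - cos b0) hM se) ?addr0//.
  + by move=> k /e1[_ ->]; rewrite cosB cospi sinpi mul0r addr0 mulN1r.
  + by move=> k /e2[_ ->]; rewrite opprK.
Qed.

(** Exchanging [b] and [B] negates [dx] and fixes [dy], and only their squares enter. *)
Lemma dz2_swap j k theta : L j = L k -> b j = B k -> B j = b k ->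
  dz2 S j theta = dz2 S k theta.
Proof.
rewrite /dz2 /dx /dy => -> -> ->; move: (_^-1) (_^-1) => s c'; ring.
Qed.

(** In the first three types paired edges have equal [dz2] and opposite signs. In the last, every
    [dz] is a signed multiple of [L k] by a common factor, and the signs make these lengths
    cancel. *)
Lemma sum_dz t theta : juncture_parameters S -> of_type S t ->
  closing_signs S t -> \sum_(1 <= k < N.+1) dz S k theta = 0.
Proof.
move=> [_ hp].
have neg j k : zneg S j = ~~ zneg S k -> dz2 S j theta = dz2 S k theta ->
    dz S k theta + dz S j theta = 0.
  by rewrite /dz => -> ->; rewrite signrN mulNr subrr.
case: t => /=.
- move=> [per _] sg; rewrite sum_pair_shift big1_seq// => k /andP[_].
  rewrite mem_index_iota => hk; have [Lk Bk bk] := per k hk.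
  by apply: neg; [exact: sg | exact: dz2_swap].
- move=> [Ls Bs _] sg; rewrite sum_pair_rev big1_seq// => k /andP[_].
  rewrite mem_index_iota => hk; apply: neg; first exact: sg.
  apply: dz2_swap; first exact: Ls.
    by rewrite Bs//; lia.
  by rewrite Bs; [congr b|]; lia.
- move=> [per _ _] sg; rewrite sum_pair_shift big1_seq// => k /andP[_].
  rewrite mem_index_iota => hk; have [Lk bk Bk] := per k hk.
  by apply: neg; [exact: sg | rewrite /dz2 /dx /dy Lk bk Bk].
case=> b0 [B0 [l /=]]; set h := if odd l then _ else _.
case=> _ hl [o1 o2] [e1 e2] _ sg.
(* [f] is the common ratio of [dz2] to [L k ^+ 2]: the four pairs of angles of type III-OAE differ
   only in the signs of the sum and of the difference of their cosines. *)
pose f := 1 - ((cos B0 - cos b0) / (2 * sin theta)) ^+ 2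
            - ((cos B0 + cos b0) / (2 * cos theta)) ^+ 2.
have cospiB x : cos (pi - x) = - cos x :> R.
  by rewrite cosB cospi sinpi mul0r addr0 mulN1r.
have dz2E k : (1 <= k <= N)%N -> dz2 S k theta = L k ^+ 2 * f.
  move=> hk; pose j := (uphalf k).
  have [kE|kE] : k = (2 * j - 1)%N \/ k = (2 * j)%N by rewrite /j; lia.
  - have [jk|jk] := leqP j l./2.
      have [|bk Bk] := o1 j; first lia.
      rewrite /dz2 /dx /dy /f kE bk Bk.
      by move: (_^-1) (_^-1) => s c'; ring.
    have [|bk Bk] := o2 j; first lia.
    rewrite /dz2 /dx /dy /f kE bk Bk !cospiB.
    by move: (_^-1) (_^-1) => s c'; ring.
  - have [jk|jk] := leqP j h.
      have [|bk Bk] := e1 j; first lia.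
      rewrite /dz2 /dx /dy /f kE bk Bk !cospiB.
      by move: (_^-1) (_^-1) => s c'; ring.
    have [|bk Bk] := e2 j; first lia.
    rewrite /dz2 /dx /dy /f kE bk Bk.
    by move: (_^-1) (_^-1) => s c'; ring.
transitivity (\sum_(1 <= k < N.+1) (-1) ^+ zneg S k * L k * Num.sqrt f).
  apply: eq_big_nat => k hk; rewrite /dz dz2E//.
  have [Lk _ _] := hp k hk.
  by rewrite sqrtrM ?sqr_ge0// sqrtr_sqr gtr0_norm// mulrA.
by rewrite -mulr_suml sg mul0r.
Qed.

Lemma sum_dv t theta : juncture_parameters S -> of_type S t ->
  closing_signs S t -> \sum_(1 <= k < N.+1) dv S k theta = 0.
Proof.
move=> hp ht hs; have [sb sB] := type_closing_sums ht.
have sz := sum_dz theta hp ht hs.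
apply/rowP => i; rewrite summxE mxE.
case: i => [[|[|[|//]]] i3].
- rewrite (eq_bigr (fun k => dx S k theta)); last by move=> k _; rewrite mxE.
  rewrite -mulr_suml (eq_bigr (fun k => L k * cos (B k) - L k * cos (b k))).
    by rewrite sumrB sb sB subrr mul0r.
  by move=> k _; rewrite mulrBr.
- rewrite (eq_bigr (fun k => dy S k theta)); last by move=> k _; rewrite mxE.
  rewrite -mulr_suml sumrN.
  rewrite (eq_bigr (fun k => L k * cos (B k) + L k * cos (b k))).
    by rewrite big_split /= sb sB addr0 oppr0 mul0r.
  by move=> k _; rewrite mulrDr.
- by rewrite (eq_bigr (fun k => dz S k theta)) // => k _; rewrite mxE.
Qed.

Lemma vertexS k theta : (0 < k)%N ->
  vertex S k.+1 theta = vertex S k theta + dv S k theta.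
Proof. by move=> k0; rewrite /vertex big_nat_recr//= addrA. Qed.

(** At [k = N] the next vertex is the first one, and the formula persists because the full sum of
    the [dv] vanishes. *)
Lemma vertex_next t k theta : juncture_parameters S -> of_type S t ->
  closing_signs S t -> (1 <= k <= N)%N ->
  vertex S (Defs.next S k) theta - vertex S k theta = dv S k theta.
Proof.
move=> hp ht hs hk; rewrite /Defs.next.
have e : vertex S k.+1 theta - vertex S k theta = dv S k theta.
  by rewrite vertexS; [rewrite addrC addKr | lia].
case: (k =P N) => // kN; rewrite -[RHS]e; congr (_ - _).
by rewrite /vertex kN (sum_dv theta hp ht hs) big_geq.
Qed.

Lemma prev_range k : (1 <= k <= N)%N -> (1 <= Defs.prev S k <= N)%N.
Proof. by rewrite /Defs.prev; case: (k =P 1%N) => ? ?; lia. Qed.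

Lemma prevK k : (1 <= k <= N)%N -> Defs.next S (Defs.prev S k) = k.
Proof.
rewrite /Defs.prev /Defs.next; case: (k =P 1%N) => [-> _|k1 hk].
  by rewrite eqxx.
by case: (k.-1 =P N); lia.
Qed.

(** * Scalar products along the flexion *)

Lemma dot_dv_u k theta : realizable S theta ->
  dot (dv S k theta) (dir_u theta) = L k * cos (b k).
Proof. by case=> s0 c0 _; rewrite dot_vec3 /dx /dy; field; rewrite s0 c0. Qed.

Lemma dot_dv_w k theta : realizable S theta ->
  dot (dv S k theta) (dir_w theta) = L k * cos (B k).
Proof. by case=> s0 c0 _; rewrite dot_vec3 /dx /dy; field; rewrite s0 c0. Qed.

(** Realizability excludes the default value 0 of the root of a negative number; the sign disappears
    in the square. *)
Lemma sqr_dz k theta : realizable S theta -> (1 <= k <= N)%N ->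
  dz S k theta ^+ 2 = dz2 S k theta.
Proof.
by case=> _ _ nn hk; rewrite /dz exprMn sqrr_sign mul1r sqr_sqrtr// nn.
Qed.

Lemma dot_dv_dv k theta : realizable S theta -> (1 <= k <= N)%N ->
  dot (dv S k theta) (dv S k theta) = L k ^+ 2.
Proof.
move=> rt hk; rewrite dot_vec3 -!expr2 sqr_dz// /dz2; ring.
Qed.

Lemma cos_sqr_lt1 (x : R) : 0 < x < pi -> 0 < 1 - cos x ^+ 2.
Proof. by move=> /andP[x0 xpi]; rewrite -sin2cos2 exprn_gt0// sin_gt0_pi ?x0. Qed.

(** * Variation of the dihedral angles on an interval of flexion *)

Section Interval.
Variables (a c : R).
Hypothesis hflex : flexes_on S a c.

(** Five values of [sin theta ^+ 2] outnumber the roots of a nonzero quartic. *)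
Lemma flex_points : exists ths : seq R,
  [/\ uniq [seq sin x ^+ 2 | x <- ths], size ths = 5
    & forall x, x \in ths -> a < x < c].
Proof.
have [ac rz] := hflex.
(* The cap at 1 keeps any two points less than [pi] apart, as [sin_sqr_neq] requires; the division
   by 6 below puts points 1 to 5 strictly inside the interval. *)
pose e := Num.min (c - a) 1.
have [e0 e1 ec] : [/\ 0 < e, e <= 1 & e <= c - a].
  by rewrite /e lt_min subr_gt0 ac ltr01 !ge_min !lexx orbT.
pose p (i : nat) := a + e / 6 * i%:R.
have pin i : (0 < i < 6)%N -> a < p i < c.
  case/andP=> i0 i6; have : 1 <= i%:R :> R by rewrite ler1n.
  have : i%:R <= 5 :> R by rewrite ler_nat.
  by rewrite /p; nra.
exists [seq p i | i <- iota 1 5]; split => //; last first.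
  by move=> x /mapP[i]; rewrite mem_iota => hi ->; apply: pin; lia.
have neq i j : (0 < i)%N -> (i < j < 6)%N -> sin (p i) ^+ 2 != sin (p j) ^+ 2.
  move=> i0 /andP[ij j6].
  have pij : p i < p j by rewrite /p ltrD2l ltr_pM2l ?ltr_nat//; lra.
  have pi_in := pin i; have pj_in := pin j.
  have /andP[pia pic] : a < p i < c by apply: pi_in; lia.
  have /andP[pja pjc] : a < p j < c by apply: pj_in; lia.
  (* The midpoint lies in the interval too, so its sine and cosine are nonzero. *)
  have [s0 c0 _] : realizable S ((p i + p j) / 2) by apply: rz; lra.
  apply: sin_sqr_neq => //; rewrite pij /=.
  have : j%:R <= 5 :> R by rewrite ler_nat.
  have : 1 <= i%:R :> R by rewrite ler1n.
  by have := @pi_ge2 R; rewrite /p; nra.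
rewrite -map_comp map_inj_in_uniq ?iota_uniq// => i j.
rewrite !mem_iota => hi hj eij; apply/eqP; apply: contraTT isT => ij.
have [lt|lt|eq] := ltngtP i j.
- by have /eqP[] := neq i j ltac:(lia) ltac:(lia).
- by have /eqP[] := neq j i ltac:(lia) ltac:(lia).
- by rewrite eq eqxx in ij.
Qed.

(** With [t = sin theta ^+ 2], the square of [dz j * dz k] equals the product of the squares;
    multiplied by the square of [t * (1 - t)], this becomes an identity between products of
    quadratics in [t]. *)
Lemma dot_dv_constant j k K : (1 <= j <= N)%N -> (1 <= k <= N)%N ->
  (forall theta, a < theta < c -> dot (dv S j theta) (dv S k theta) = K) ->
  K ^+ 2 = L j ^+ 2 * L k ^+ 2.
Proof.
move=> hj hk HK; have [_ rz] := hflex.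
have [ths [uths sths inths]] := flex_points.
(* Numerators: [dx] is [A i / sin theta] and [dy] is [- C i / cos theta]. *)
pose A i := L i * (cos (B i) - cos (b i)) / 2.
pose C i := L i * (cos (B i) + cos (b i)) / 2.
(* The leading coefficients come out as [- K], [- L j ^+ 2] and [- L k ^+ 2]. *)
rewrite -sqrrN -[RHS]mulrNN.
apply: (@quadratic_sqr_lead R
  (- L j ^+ 2) (L j ^+ 2 + A j ^+ 2 - C j ^+ 2) (- A j ^+ 2)
  (- L k ^+ 2) (L k ^+ 2 + A k ^+ 2 - C k ^+ 2) (- A k ^+ 2)
  (- K) (K + A j * A k - C j * C k) (- (A j * A k)) _ uths).
  by rewrite size_map sths.
move=> _ /mapP[theta /inths hth ->].
have rt := rz _ hth; have [s0 c0 _] := rt.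
have cs := sin2cos2 theta.
have quadE i : (1 <= i <= N)%N ->
    - L i ^+ 2 * (sin theta ^+ 2) ^+ 2 +
      (L i ^+ 2 + A i ^+ 2 - C i ^+ 2) * sin theta ^+ 2 - A i ^+ 2 =
    sin theta ^+ 2 * cos theta ^+ 2 * dz S i theta ^+ 2.
  move=> hi; rewrite sqr_dz//.
  have -> : sin theta ^+ 2 * cos theta ^+ 2 * dz2 S i theta =
    sin theta ^+ 2 * cos theta ^+ 2 * L i ^+ 2 - cos theta ^+ 2 * A i ^+ 2
      - sin theta ^+ 2 * C i ^+ 2.
    by rewrite /dz2 /dx /dy /A /C; field; rewrite s0 c0.
  by rewrite cs; ring.
rewrite !quadE//.
have -> : - K * (sin theta ^+ 2) ^+ 2 +
      (K + A j * A k - C j * C k) * sin theta ^+ 2 - A j * A k =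
    sin theta ^+ 2 * cos theta ^+ 2 * (dz S j theta * dz S k theta).
  (* The constant scalar product expresses the product of the two square roots without roots. *)
  have -> : dz S j theta * dz S k theta =
      K - dx S j theta * dx S k theta - dy S j theta * dy S k theta.
    by rewrite -(HK _ hth) dot_vec3; ring.
  have -> : sin theta ^+ 2 * cos theta ^+ 2 *
      (K - dx S j theta * dx S k theta - dy S j theta * dy S k theta) =
      sin theta ^+ 2 * cos theta ^+ 2 * K - cos theta ^+ 2 * (A j * A k)
      - sin theta ^+ 2 * (C j * C k).
    by rewrite /dx /dy /A /C; field; rewrite s0 c0.
  by rewrite cs; ring.
by ring.
Qed.

(* The two directions [dir_u] and [dir_w] are treated at once: [g k] is the
   angle between the edge [k] and [e theta]. *)
Lemma nonconstant_dihedral_parallel (e : R -> 'rV[R]_3) (g : nat -> R) j k :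
  (1 <= j <= N)%N -> (1 <= k <= N)%N ->
  0 < L j -> 0 < L k -> 0 < g j < pi -> 0 < g k < pi ->
  (forall theta, dot (e theta) (e theta) = 1) ->
  (forall i theta, realizable S theta ->
     dot (dv S i theta) (e theta) = L i * cos (g i)) ->
  (exists2 theta, a < theta < c &
     row_free (col_mx (- dv S j theta) (dv S k theta))) ->
  nonconstant_on a c
    (fun theta => dihedral (e theta) (- dv S j theta) (dv S k theta)).
Proof.
move=> hj hk Lj Lk gj gk ee dve [theta0 hth0 free0].
have [ac rz] := hflex.
apply: contrapT => /nonconstant_or cst.
(* [nj] and [nk] are the lengths of the components of the edges orthogonal to [e theta]: independent
   of [theta], and nonzero since [g] lies strictly between 0 and [pi]. *)
pose nj := Num.sqrt (L j ^+ 2 - (L j * cos (g j)) ^+ 2).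
pose nk := Num.sqrt (L k ^+ 2 - (L k * cos (g k)) ^+ 2).
have n_gt0 i : 0 < L i -> 0 < g i < pi ->
    0 < Num.sqrt (L i ^+ 2 - (L i * cos (g i)) ^+ 2).
  move=> Li gi; rewrite sqrtr_gt0 exprMn -{1}[L i ^+ 2]mulr1 -mulrBr.
  by rewrite mulr_gt0 ?exprn_gt0// cos_sqr_lt1.
have nj0 : nj != 0 by rewrite gt_eqF// n_gt0.
have nk0 : nk != 0 by rewrite gt_eqF// n_gt0.
(* This is [cos_dihedral] solved for the scalar product; the cosine carries a minus sign because
   edge [j] is reversed. *)
have dotE theta : a < theta < c -> dot (dv S j theta) (dv S k theta) =
    (L j * cos (g j)) * (L k * cos (g k)) -
    cos (dihedral (e theta) (- dv S j theta) (dv S k theta)) * (nj * nk).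
  move=> hth; have rt := rz _ hth.
  rewrite cos_dihedral ee ?oner_neq0// !divr1.
  rewrite !dotNl ![dot (dv S j theta) (- _)]dotC !dotNl !dve// !dot_dv_dv//.
  by rewrite opprK sqrrN -/nj -/nk; field; rewrite nj0 nk0.
(* The constant is taken at [theta0], where the two edges are independent, to contradict the
   equality case of Cauchy-Schwarz there. *)
have := @dot_dv_constant j k (dot (dv S j theta0) (dv S k theta0)) hj hk.
have rt0 := rz _ hth0.
rewrite -(dot_dv_dv rt0 hj) -(dot_dv_dv rt0 hk) => eqK.
have : ~~ row_free (col_mx (- dv S j theta0) (dv S k theta0)).
  have jj : dot (- dv S j theta0) (- dv S j theta0) = L j ^+ 2.
    by rewrite dotNl dotC dotNl opprK dot_dv_dv.
  apply: cauchy_schwarz_eq_not_free.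
    by rewrite jj expf_neq0// gt_eqF.
  rewrite jj dotNl sqrrN eqK ?dot_dv_dv// => theta hth.
  by rewrite !dotE// (cst _ _ hth hth0).
by rewrite free0.
Qed.

(** The components of [u] and [w] orthogonal to the edge have constant nonzero lengths [nb] and
    [nB], while the scalar product of [u] and [w] is [1 - 2 * sin theta ^+ 2]. A constant angle
    would therefore fix [sin theta ^+ 2]. *)
Lemma nonconstant_dihedral_juncture k : (1 <= k <= N)%N ->
  0 < L k -> 0 < b k < pi -> 0 < B k < pi ->
  nonconstant_on a c
    (fun theta => dihedral (dv S k theta) (dir_u theta) (dir_w theta)).
Proof.
move=> hk Lk bk Bk; have [_ rz] := hflex.
apply: contrapT => /nonconstant_or cst.
have [ths [uths sths inths]] := flex_points.
pose nb := Num.sqrt (1 - cos (b k) ^+ 2).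
pose nB := Num.sqrt (1 - cos (B k) ^+ 2).
have nb0 : nb != 0 by rewrite gt_eqF// sqrtr_gt0 cos_sqr_lt1.
have nB0 : nB != 0 by rewrite gt_eqF// sqrtr_gt0 cos_sqr_lt1.
have L0 : L k != 0 by rewrite gt_eqF.
have sinE theta : a < theta < c -> sin theta ^+ 2 =
    (1 - cos (b k) * cos (B k) -
     cos (dihedral (dv S k theta) (dir_u theta) (dir_w theta)) * (nb * nB)) / 2.
  move=> hth; have rt := rz _ hth.
  rewrite cos_dihedral dot_dv_dv ?expf_neq0//.
  rewrite ![dot _ (dv S k theta)]dotC dot_dv_u// dot_dv_w//.
  have -> : dot (dir_u theta) (dir_u theta) = 1.
    by rewrite dot_vec3 -(cos2Dsin2 theta); ring.
  have -> : dot (dir_w theta) (dir_w theta) = 1.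
    by rewrite dot_vec3 -(cos2Dsin2 theta); ring.
  have -> : dot (dir_u theta) (dir_w theta) = 1 - 2 * sin theta ^+ 2.
    by rewrite dot_vec3; have := cos2Dsin2 theta; nra.
  rewrite !exprMn ![L k ^+ 2 * _ / _]mulrAC divff ?expf_neq0// !mul1r -/nb -/nB.
  by field; rewrite nb0 nB0 L0.
(* Two of the five points already give different values of [sin theta ^+ 2]. *)
case: ths uths sths inths => [//|x [//|y ths]] /= /andP[xy _] _ inths.
have hx : a < x < c by apply: inths; rewrite inE eqxx.
have hy : a < y < c by apply: inths; rewrite !inE eqxx orbT.
move: xy; rewrite inE negb_or => /andP[/eqP[]].
by rewrite !sinE// (cst _ _ hx hy).
Qed.

End Interval.

End Flexion.

(** * Transfer to the angles of the suspension *)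

Lemma eq_nonconstant_on (R : realType) (a c : R) (f g : R -> R) :
  f =1 g -> nonconstant_on a c f -> nonconstant_on a c g.
Proof. by move=> fg [x [y []]]; rewrite !fg => *; exists x, y. Qed.

Theorem mainTheorem5 (R : realType) (S : suspension R) (t : suspension_type)
    (hS : juncture_parameters S) (ht : of_type S t) (hs : closing_signs S t)
    (a c : R) (hflex : flexes_on S a c)
    (k : nat) (hk : (1 <= k <= nsides S)%N) :
  nonconstant_on a c (eps S k) /\
  (proper_vertex S a c k ->
     nonconstant_on a c (delta S k) /\ nonconstant_on a c (delta' S k)).
Proof.
have [Lk bk Bk] := hS.2 k hk.
have hj := prev_range hk; have [Lj bj Bj] := hS.2 _ hj.
have nextE theta := vertex_next theta hS ht hs hk.
(* The preceding edge ends at [v_k], so it is reversed when seen from there. *)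
have prevE theta : vertex S (Defs.prev S k) theta - vertex S k theta =
    - dv S (Defs.prev S k) theta.
  by rewrite -(vertex_next theta hS ht hs hj) prevK// opprB.
split.
  apply: eq_nonconstant_on (nonconstant_dihedral_juncture hflex hk Lk bk Bk).
  by move=> theta; rewrite /eps nextE.
case=> theta0 hth0; rewrite prevE nextE => free0.
have free : exists2 theta, a < theta < c &
    row_free (col_mx (- dv S (Defs.prev S k) theta) (dv S k theta)) by exists theta0.
split.
- apply: eq_nonconstant_on (nonconstant_dihedral_parallel (e := @dir_u R)
    hflex hj hk Lj Lk bj bk _ (@dot_dv_u R S) free) => theta.
  + by rewrite /delta nextE prevE.
  + by rewrite dot_vec3 -(cos2Dsin2 theta); ring.
- apply: eq_nonconstant_on (nonconstant_dihedral_parallel (e := @dir_w R)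
    hflex hj hk Lj Lk Bj Bk _ (@dot_dv_w R S) free) => theta.
  + by rewrite /delta' nextE prevE.
  + by rewrite dot_vec3 -(cos2Dsin2 theta); ring.
Qed.
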